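(* Let $a, b, c$ be positive real numbers. Then $$\int_{0}^{1} x^{a-1} (1-x^{c})^{b-1} \, \ln x \, dx = \frac{\Gamma(a/c) \, \Gamma(b)}{c^{2} \, \Gamma(a/c+b)} \left( \psi \left(\frac{a}{c} \right) - \psi \left(\frac{a}{c}+b \right) \right).$$
   Context: $\Gamma(x)=\int_0^\infty t^{x-1}e^{-t}\,dt$ for $x>0$ is the gamma function, and $\psi$ denotes the digamma function, $\psi(x) = \frac{d}{dx}\log\Gamma(x) = \Gamma'(x)/\Gamma(x)$. *)

(* Defs.v *)
From mathcomp Require Import all_boot all_order all_algebra.
From mathcomp Require Import all_classical all_reals all_analysis.

Set Implicit Arguments.
Unset Strict Implicit.
Unset Printing Implicit Defensive.

Import Order.TTheory GRing.Theory Num.Theory.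
Import numFieldNormedType.Exports.

Local Open Scope classical_set_scope.
Local Open Scope ring_scope.

(* The integral is finite for 0 < x; Rintegral returns 0 when the
   extended-real integral is infinite. *)
Definition Gamma {R : realType} (x : R) : R :=
  \int[lebesgue_measure]_(t in `]0%R, +oo[) (t `^ (x - 1) * expR (- t)).

Definition digamma {R : realType} (x : R) : R :=
  derive1 (fun y : R => ln (Gamma y)) x.

(* Main.v *)
Require Import Defs.
From mathcomp Require Import all_boot all_order all_algebra.
From mathcomp Require Import all_classical all_reals all_analysis.
From mathcomp Require Import measurable_realfun.
From mathcomp Require Import ring lra.

(** The integral is the derivative, with respect to the exponent [a], of
    [I a = \int_0^1 x^(a-1) (1 - x^c)^(b-1) dx], because differentiating
    [x^(a-1)] in [a] produces the factor [ln x].  So two facts suffice: a closed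
    form for [I], and the right to differentiate under the integral sign.

    The closed form is [I a = Gamma p * Gamma b / (c * Gamma (p + b))] with
    [p = a / c] ([integral_beta_type]).  It is Euler's computation of the Beta
    integral: write [Gamma p * Gamma b] as a double integral in [s] and [t],
    substitute [t = s (x^(-c) - 1)] with [x] in the unit interval, exchange the
    integrations by Tonelli's theorem, and recognise
    [\int_0^oo s^(p+b-1) exp(- s x^(-c)) ds = x^(c(p+b)) Gamma (p + b)].  The
    integrands are singular at the ends of open intervals, so the changes of
    variables rest on a version for nonnegative integrands on open sets,
    obtained by exhaustion with compact intervals
    ([ge0_integration_by_substitution_decreasing_open]).

    Both [Gamma] and [I] are Mellin transforms
    [M y = \int_D t^(y-1) w t dt], with [D] contained in the positive half-line
    and respective weights [w t = exp(- t)] and [w t = (1 - t^c)^(b-1)].  If such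
    an integral converges absolutely for all positive [y], then it can be
    differentiated under the integral sign at all positive [y]
    ([is_derive1_mellin]), since [|ln t| <= (t^d + t^(-d)) / d] trades the
    logarithm for a small change of exponent.  Applied to [Gamma], this gives
    [digamma = Gamma' / Gamma] ([digammaE]); applied to [I], it identifies the
    integral of the statement with the derivative at [a] of the closed form,
    which the quotient rule expresses through digamma ([is_derive1_beta]). *)

Import Order.TTheory GRing.Theory Num.Theory.
Import numFieldNormedType.Exports.

Local Open Scope classical_set_scope.
Local Open Scope ring_scope.

(** * Change of variables on open sets *)

Section Substitution.
Context {R : realType}.
Notation mu := lebesgue_measure.

Lemma is_derive1_continuous (F : R -> R) (x d : R) :
  is_derive x 1 F d -> {for x, continuous F}.
Proof.
move=> [dF _].
exact/differentiable_continuous/derivable1_diffP.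
Qed.

Lemma continuous_within_itvcc (G : R -> R) (a b : R) :
  (forall y, y \in `[a, b] -> {for y, continuous G}) ->
  {within `[a, b], continuous G}.
Proof.
move=> cG; apply: continuous_in_subspaceT => y; rewrite inE => yab.
exact: cG.
Qed.

(** On a compact interval a decreasing [C^1] change of variables asks for
    continuity of [G] up to the endpoints, which fails for integrands with an
    end singularity such as [t `^ (z - 1)].  Exhausting the open set [I] by the
    compact intervals [[a n, b n]] and passing to the limit by monotone
    convergence on both sides lifts this restriction when [G >= 0]. *)
Lemma ge0_integration_by_substitution_decreasing_open (F f G : R -> R)
    (a b : R^nat) (I : set R) :
  open I -> I = \bigcup_n `[a n, b n]%classic ->
  (forall n, a n <= b n) -> nonincreasing_seq a -> nondecreasing_seq b ->
  (forall x, I x -> is_derive x 1 F (f x)) ->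
  (forall x, I x -> {for x, continuous f}) ->
  (forall x, I x -> f x < 0) ->
  (forall x, I x -> {for F x, continuous G}) ->
  (forall x, I x -> 0 <= G (F x)) ->
  (\int[mu]_(y in F @` I) (G y)%:E =
   \int[mu]_(x in I) (G (F x) * - f x)%:E)%E.
Proof.
move=> oI IE ab nia ndb dF cf f_lt0 cG G0.
have abI n x : x \in `[a n, b n] -> I x by move=> xab; rewrite IE; exists n.
have cF x : I x -> {for x, continuous F}.
  by move=> /dF; exact: is_derive1_continuous.
have f'E x : I x -> derive1 F x = f x.
  by move=> /dF [_ <-]; rewrite derive1E.
have cf' x : I x -> {for x, continuous (derive1 F)}.
  move=> Ix; rewrite /prop_for /continuous_at f'E//.
  apply: cvg_trans (cf _ Ix); apply: near_eq_cvg.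
  near=> y; rewrite f'E//; near: y; exact: (open_nbhs_nbhs (conj oI Ix)).
have cFn n : {within `[a n, b n], continuous F}.
  by apply: continuous_within_itvcc => x /abI; exact: cF.
have oc n x : x \in `]a n, b n[ -> I x.
  by move/subset_itv_oo_cc; exact: abI.
have an n : I (a n) by apply: (abI n); rewrite in_itv/= lexx ab.
have bn n : I (b n) by apply: (abI n); rewrite in_itv/= lexx ab.
have decF n : {in `[a n, b n] &, {homo F : x y /~ x < y}}.
  apply: ltr0_derive1_lt_cc => //.
  - by move=> x /oc /dF[].
  - by move=> x /oc Ix; rewrite f'E// f_lt0.
(* A decreasing continuous function exchanges the endpoints of a segment; the
   intermediate value theorem gives surjectivity. *)
have imF n : F @` `[a n, b n]%classic = `[F (b n), F (a n)]%classic.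
  apply/seteqP; split => [_ [x xab <-]|y].
    have [xa xb] : a n <= x /\ x <= b n.
      by move: xab; rewrite /= in_itv/= => /andP.
    rewrite /= in_itv/=; apply/andP; split.
      move: xb; rewrite [x <= _]le_eqVlt => /predU1P[->//|xb].
      by apply/ltW/(decF n) => //; rewrite in_itv/= lexx ab.
    move: xa; rewrite [a n <= _]le_eqVlt => /predU1P[->//|xa].
    by apply/ltW/(decF n) => //; rewrite in_itv/= lexx ab.
  rewrite /= in_itv/= => /andP[y1 y2].
  have [|c ? ?] := @IVT _ F (a n) (b n) y (ab n) (cFn n); last by exists c.
  by rewrite ge_min y1 orbT le_max y2.
have sub n : (\int[mu]_(y in `[F (b n), F (a n)]) (G y)%:E =
   \int[mu]_(x in `[a n, b n]) (G (F x) * - f x)%:E)%E.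
  rewrite integration_by_substitution_decreasing//.
  - apply: eq_integral => x; rewrite inE => /abI Ix.
    by rewrite !fctE f'E.
  - by move=> x /oc; exact: cf'.
  - apply/cvg_ex; exists (derive1 F (a n)).
    by apply: cvg_at_right_filter; exact: cf'.
  - apply/cvg_ex; exists (derive1 F (b n)).
    by apply: cvg_at_left_filter; exact: cf'.
  - split.
    + by move=> x /oc /dF[].
    + by apply: cvg_at_right_filter; exact: cF.
    + by apply: cvg_at_left_filter; exact: cF.
  - apply: continuous_within_itvcc => y yab.
    have : (F @` `[a n, b n]%classic) y by rewrite imF.
    by move=> [x /abI Ix <-]; exact: cG.
have ndI : {homo (fun n => `[a n, b n]%classic) :
    n m / (n <= m)%N >-> (n <= m)%O}.
  move=> n m nm; rewrite subsetEset => x; rewrite /= !in_itv/= => /andP[xa xb].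
  by rewrite (le_trans (nia _ _ nm) xa) (le_trans xb (ndb _ _ nm)).
have cvg1 := @ge0_nondecreasing_set_cvg_integral _ (measurableTypeR R) R
  (fun n => `[a n, b n]%classic) (fun x => (G (F x) * - f x)%:E) mu ndI.
have cvg2 := @ge0_nondecreasing_set_cvg_integral _ (measurableTypeR R) R
  (fun n => F @` `[a n, b n]%classic) (fun x => (G x)%:E) mu.
rewrite IE image_bigcup.
apply: (cvg_unique _ (cvg2 _ _ _ _)) => //.
- move=> n m nm; rewrite subsetEset; apply: image_subset.
  by rewrite -subsetEset ndI.
- by move=> n; rewrite imF; exact: measurable_itv.
- move=> n; apply/measurable_EFinP; rewrite imF.
  apply: subspace_continuous_measurable_fun => //.
  apply: continuous_within_itvcc => y yab.
  have : (F @` `[a n, b n]%classic) y by rewrite imF.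
  by move=> [x /abI Ix <-]; exact: cG.
- by move=> n _ [x /abI Ix <-]; rewrite lee_fin G0.
rewrite (_ : (fun i => _) = (fun n =>
  \int[mu]_(x in `[a n, b n]) (G (F x) * - f x)%:E)%E); last first.
  by apply/funext => n; rewrite imF sub.
apply: cvg1 => //.
- move=> n; apply/measurable_EFinP.
  apply: subspace_continuous_measurable_fun => //.
  apply: continuous_within_itvcc => x /abI Ix.
  apply: (@continuousM R R (G \o F) (\- f)).
    by apply: continuous_comp; [exact: cF | exact: cG].
  by apply: continuousN; exact: cf.
- by move=> n x /abI Ix; rewrite lee_fin mulr_ge0 ?G0// oppr_ge0 ltW ?f_lt0.
Unshelve. all: end_near. Qed.

End Substitution.

(** * Change of variables on the half-line and the unit interval *)

Section HalfLine.
Context {R : realType}.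
Notation mu := lebesgue_measure.

Lemma bigcup_itvoy :
  `]0, +oo[%classic = \bigcup_n `[n.+1%:R^-1, n.+1%:R]%classic :> set R.
Proof.
apply/seteqP; split => [x|x [n _]]; rewrite /= in_itv/=; last first.
  by move=> /andP[nx _]; rewrite in_itv/= andbT (lt_le_trans _ nx)// invr_gt0.
rewrite andbT => x0.
pose m := maxn (Num.truncn x) (Num.truncn x^-1).
have mx (y : R) : (Num.truncn y <= m)%N -> y <= m.+1%:R.
  by move=> ym; rewrite (le_trans (ltW (truncnS_gt y)))// ler_nat.
exists m => //=; rewrite in_itv/= mx ?leq_maxl// andbT.
by rewrite -[leRHS]invrK lef_pV2 ?posrE ?invr_gt0// mx// leq_maxr.
Qed.

Lemma bigcup_itv01 :
  `]0, 1[%classic = \bigcup_n `[n.+2%:R^-1, 1 - n.+2%:R^-1]%classic :> set R.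
Proof.
apply/seteqP; split => [x|x [n _]]; rewrite /= in_itv/=; last first.
  move=> /andP[nx xn]; rewrite in_itv/= (lt_le_trans _ nx) ?invr_gt0//=.
  by rewrite (le_lt_trans xn)// ltrBlDr ltrDl invr_gt0.
move=> /andP[x0 x1].
pose m := maxn (Num.truncn x^-1) (Num.truncn (1 - x)^-1).
have mx (y : R) : 0 < y -> (Num.truncn y^-1 <= m)%N -> m.+2%:R^-1 <= y.
  move=> y0 ym; rewrite -[leRHS]invrK lef_pV2 ?posrE ?invr_gt0//.
  by rewrite (le_trans (ltW (truncnS_gt _)))// ler_nat ltnS (leq_trans ym).
exists m => //=; rewrite in_itv/= mx ?leq_maxl//= lerBrDl -lerBrDr.
by rewrite mx ?leq_maxr// subr_gt0.
Qed.

Lemma ge0_integration_by_substitution_decreasing_oy (F f G : R -> R) :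
  (forall x : R, 0 < x -> is_derive x 1 F (f x)) ->
  (forall x : R, 0 < x -> {for x, continuous f}) ->
  (forall x : R, 0 < x -> f x < 0) ->
  (forall x : R, 0 < x -> {for F x, continuous G}) ->
  (forall x : R, 0 < x -> 0 <= G (F x)) ->
  (\int[mu]_(y in F @` `]0%R, +oo[) (G y)%:E =
   \int[mu]_(x in `]0%R, +oo[) (G (F x) * - f x)%:E)%E.
Proof.
have oI : open (`]0, +oo[%classic : set R) by exact: interval_open.
have oyE (x : R) : `]0, +oo[%classic x -> 0 < x by rewrite /= in_itv/= andbT.
move=> dF cf f0 cG G0.
apply: (ge0_integration_by_substitution_decreasing_open F f G
  (fun n => n.+1%:R^-1) (fun n => n.+1%:R) _ oI
  bigcup_itvoy _ _ _ (fun x xI => dF x (oyE x xI))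
  (fun x xI => cf x (oyE x xI)) (fun x xI => f0 x (oyE x xI))
  (fun x xI => cG x (oyE x xI)) (fun x xI => G0 x (oyE x xI))) => //.
- by move=> n; rewrite (@le_trans _ _ 1)// ?invf_le1// ler1n.
- by move=> n m nm; rewrite lef_pV2 ?posrE// ler_nat.
- by move=> n m nm; rewrite ler_nat.
Qed.

Lemma ge0_integration_by_substitution_decreasing_01 (F f G : R -> R) :
  (forall x : R, 0 < x < 1 -> is_derive x 1 F (f x)) ->
  (forall x : R, 0 < x < 1 -> {for x, continuous f}) ->
  (forall x : R, 0 < x < 1 -> f x < 0) ->
  (forall x : R, 0 < x < 1 -> {for F x, continuous G}) ->
  (forall x : R, 0 < x < 1 -> 0 <= G (F x)) ->
  (\int[mu]_(y in F @` `]0%R, 1%R[) (G y)%:E =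
   \int[mu]_(x in `]0%R, 1%R[) (G (F x) * - f x)%:E)%E.
Proof.
have oI : open (`]0, 1[%classic : set R) by exact: interval_open.
have oyE (x : R) : `]0, 1[%classic x -> 0 < x < 1 by rewrite /= in_itv/=.
move=> dF cf f0 cG G0.
apply: (ge0_integration_by_substitution_decreasing_open F f G
  (fun n => n.+2%:R^-1) (fun n => 1 - n.+2%:R^-1) _ oI
  bigcup_itv01 _ _ _ (fun x xI => dF x (oyE x xI))
  (fun x xI => cf x (oyE x xI)) (fun x xI => f0 x (oyE x xI))
  (fun x xI => cG x (oyE x xI)) (fun x xI => G0 x (oyE x xI))) => //.
- move=> n; have : n.+2%:R^-1 <= 2^-1 :> R by rewrite lef_pV2 ?posrE// ler_nat.
  by move: n.+2%:R^-1 => u; lra.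
- by move=> n m nm; rewrite lef_pV2 ?posrE// ler_nat.
- by move=> n m nm; rewrite lerB// lef_pV2 ?posrE// ler_nat.
Qed.

Lemma continuous_powR_gt0 (p x : R) : 0 < x ->
  {for x, continuous (fun y => y `^ p)}.
Proof. by move=> /(is_derive1_powR p); exact: is_derive1_continuous. Qed.

Lemma image_div_itvoy (k : R) : 0 < k ->
  [set k / x | x in `]0%R, +oo[%classic] = `]0, +oo[%classic.
Proof.
move=> k0; apply/seteqP; split => [_ [x + <-]|y]; rewrite /= !in_itv/= !andbT.
  by move=> x0; rewrite divr_gt0.
move=> y0; exists (k / y); first by rewrite /= in_itv/= andbT divr_gt0.
by rewrite invf_div mulrCA divff ?mulr1// gt_eqF.
Qed.

(** The map [x |-> k / x] is a decreasing involution of the half-line; it is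
    only a device to reach the increasing map [x |-> k * x] below. *)
Lemma ge0_integral_inversion (k : R) (G : R -> R) : 0 < k ->
  (forall x : R, 0 < x -> {for x, continuous G}) ->
  (forall x : R, 0 < x -> 0 <= G x) ->
  (\int[mu]_(y in `]0%R, +oo[) (G y)%:E =
   \int[mu]_(x in `]0%R, +oo[) (G (k / x) * (k * x ^- 2))%:E)%E.
Proof.
move=> k0 cG G0.
have dF (x : R) : 0 < x -> is_derive x 1 (fun x => k / x) (k * - x ^- 2).
  move=> x0; have xN0 : x != 0 by rewrite gt_eqF.
  have /(is_deriveZ k) := is_deriveV xN0 (is_derive_id x 1).
  by rewrite [_ *: 1]mulr1.
rewrite -{1}(image_div_itvoy _ k0).
rewrite (ge0_integration_by_substitution_decreasing_oy _ _ _ dF).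
- by apply: eq_integral => x _; rewrite [k * - _]mulrN opprK.
- move=> x x0; have xN0 : x != 0 by rewrite gt_eqF.
  apply: (@continuousM R R (fun=> k) (fun x => - x ^- 2)).
    exact: cst_continuous.
  apply: continuousN; apply: continuousV; first by rewrite expf_neq0.
  exact: exprn_continuous.
- by move=> x x0; rewrite mulrN oppr_lt0 mulr_gt0// invr_gt0 exprn_gt0.
- by move=> x x0; apply: cG; rewrite divr_gt0.
- by move=> x x0; apply: G0; rewrite divr_gt0.
Qed.

(** Scaling by [k] is the inversion [x |-> k / x] after the inversion
    [x |-> 1 / x]: both sides become the same integral after one inversion. *)
Lemma ge0_integral_scaling (k : R) (G : R -> R) : 0 < k ->
  (forall x : R, 0 < x -> {for x, continuous G}) ->
  (forall x : R, 0 < x -> 0 <= G x) ->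
  (\int[mu]_(y in `]0%R, +oo[) (G y)%:E =
   \int[mu]_(x in `]0%R, +oo[) (G (k * x) * k)%:E)%E.
Proof.
move=> k0 cG G0; rewrite (ge0_integral_inversion k)//.
rewrite [RHS](ge0_integral_inversion 1)//.
- by apply: eq_integral => x _; rewrite div1r mul1r mulrA.
- move=> x x0; apply: (@continuousM R R (fun x => G (k * x)) (fun=> k)).
    apply: (@continuous_comp _ _ _ (fun x => k * x) G).
      exact: mulrl_continuous.
    by apply: cG; rewrite mulr_gt0.
  exact: cst_continuous.
- by move=> x x0; rewrite mulr_ge0 ?(ltW k0)//; apply: G0; rewrite mulr_gt0.
Qed.

End HalfLine.

(** * Convergence and positivity of the Gamma integral *)

Section GammaFinite.
Context {R : realType}.
Notation mu := lebesgue_measure.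

Lemma measurable_fun_powR d (T : measurableType d) (D : set T) (f : T -> R)
  (p : R) : measurable_fun D f -> measurable_fun D (fun x => f x `^ p).
Proof.
by move=> mf; apply: (@measurableT_comp _ _ _ _ _ _ (fun y : R => y `^ p)).
Qed.

Lemma measurable_gamma_integrand (z : R) (D : set R) :
  measurable_fun D (fun t : R => t `^ (z - 1) * expR (- t)).
Proof.
apply: measurable_funTS; apply: measurable_funM; first exact: measurable_powR.
by apply: measurableT_comp.
Qed.

Lemma gamma_integrand_ge0 (z t : R) : 0 <= t `^ (z - 1) * expR (- t).
Proof. by rewrite mulr_ge0 ?powR_ge0 ?expR_ge0. Qed.

(** With [u = t / y], this is the [y]-th power of [u <= exp u]. *)
Lemma powR_le_expR (t y : R) : 0 < t -> 0 < y -> t `^ y <= y `^ y * expR t.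
Proof.
move=> t0 y0; have yN0 : y != 0 by rewrite gt_eqF.
have ty0 : 0 <= t / y by rewrite ltW// divr_gt0.
have {1}-> : t = y * (t / y) by rewrite mulrCA divff// mulr1.
rewrite powRM ?(ltW y0)// ler_pM2l ?powR_gt0//.
have {2}-> : t = t / y * y by rewrite divfK.
rewrite expRM ge0_ler_powR ?nnegrE ?expR_ge0 ?(ltW y0)//.
by rewrite (le_trans _ (expR_ge1Dx _))// lerDr.
Qed.

(** The integrand is the opposite of the derivative of [(1 + t `^ z)^-1], which
    decreases from 1 to 0; reading this as a change of variables with the
    constant integrand 1 on the unit interval gives the value. *)
Lemma ge0_integral_logistic (z : R) : 0 < z ->
  (\int[mu]_(t in `]0%R, +oo[) (z * t `^ (z - 1) / (1 + t `^ z) ^+ 2)%:E = 1)%E.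
Proof.
move=> z0.
have p0 (t : R) : 0 < 1 + t `^ z by rewrite ltr_pwDl// powR_ge0.
have pN0 (t : R) : 1 + t `^ z != 0 by rewrite gt_eqF.
have dF (t : R) : 0 < t -> is_derive t 1 (fun t => (1 + t `^ z)^-1)
    (- (1 + t `^ z) ^- 2 * (z * t `^ (z - 1))).
  move=> t0; apply: (@is_deriveV R (fun t => 1 + t `^ z) t _ 1 (pN0 t)).
  have := is_deriveD (is_derive_cst (1 : R) t 1) (is_derive1_powR z t0).
  by rewrite add0r.
have im : [set (1 + t `^ z)^-1 | t in `]0, +oo[%classic] = `]0%R, 1%R[%classic.
  apply/seteqP; split => [_ [t + <-]|y]; rewrite /= !in_itv/=.
    by rewrite andbT => t0; rewrite invr_gt0 p0/= invf_lt1// ltrDl powR_gt0.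
  move=> /andP[y0 y1]; exists ((y^-1 - 1) `^ z^-1).
    by rewrite /= in_itv/= andbT powR_gt0// subr_gt0 invf_gt1.
  rewrite -powRrM mulVf ?gt_eqF// powRr1 ?subr_ge0 ?invf_ge1 ?ltW//.
  by rewrite addrC subrK invrK.
transitivity (\int[mu]_(y in `]0%R, 1%R[) (cst (1 : R) y)%:E)%E; last first.
  rewrite [LHS](integral_cst mu (measurable_itv _) 1%:E).
  by rewrite /= lebesgue_measure_itv/= lte01 oppr0 adde0 mule1.
rewrite -{1}im (ge0_integration_by_substitution_decreasing_oy _ _ _ dF).
- apply: eq_integral => t _; congr EFin.
  by rewrite mul1r mulNr opprK mulrC.
- move=> t t0.
  apply: (@continuousM R R (fun t => - (1 + t `^ z) ^- 2)
                           (fun t => z * t `^ (z - 1))); last first.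
    apply: (@continuousM R R (fun=> z)); first exact: cst_continuous.
    exact: continuous_powR_gt0.
  apply: continuousN; apply: continuousV; first by rewrite expf_neq0.
  apply: (@continuous_comp _ _ _ (fun t => 1 + t `^ z) (fun y => y ^+ 2)).
    apply: (@continuousD R R R (fun=> 1)); first exact: cst_continuous.
    exact: continuous_powR_gt0.
  exact: exprn_continuous.
- move=> t t0; rewrite mulNr oppr_lt0 mulr_gt0 ?mulr_gt0 ?powR_gt0//.
  by rewrite invr_gt0 exprn_gt0.
- by move=> t t0; exact: cst_continuous.
- by [].
Qed.

(** Comparison with an integrand of known integral, valid both near 0 and near
    infinity: [(1 + u)^2 <= 2 + 2 u^2], and [expR t] dominates both 1 and, up to
    the factor [(2 * z) `^ (2 * z)], the power [u^2 = t `^ (2 * z)]. *)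
Lemma gamma_integrand_le (z t : R) : 0 < z -> 0 < t ->
  t `^ (z - 1) * expR (- t) <= (2 + 2 * (2 * z) `^ (2 * z)) / z *
    (z * t `^ (z - 1) / (1 + t `^ z) ^+ 2).
Proof.
move=> z0 t0.
have p0 : 0 < 1 + t `^ z by rewrite ltr_pwDl// powR_ge0.
have -> : (2 + 2 * (2 * z) `^ (2 * z)) / z *
    (z * t `^ (z - 1) / (1 + t `^ z) ^+ 2) =
    t `^ (z - 1) * ((2 + 2 * (2 * z) `^ (2 * z)) / (1 + t `^ z) ^+ 2).
  by field; rewrite !gt_eqF.
rewrite ler_pM2l ?powR_gt0// ler_pdivlMr ?exprn_gt0//.
have u2 : (t `^ z) ^+ 2 <= (2 * z) `^ (2 * z) * expR t.
  rewrite -powR_mulrn ?powR_ge0// -powRrM (mulrC z).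
  by rewrite powR_le_expR// mulr_gt0.
have et0 : 0 < expR t := expR_gt0 t.
have et1 : 1 <= expR t by rewrite (le_trans _ (expR_ge1Dx t))// lerDl ltW.
rewrite expRN mulrC ler_pdivrMr//.
have : 0 <= (1 - t `^ z) ^+ 2 by exact: sqr_ge0.
move: (t `^ z) u2 => u.
move: (_ `^ _) => w.
nra.
Qed.

Lemma integrable_gamma_integrand (z : R) : 0 < z ->
  mu.-integrable `]0%R, +oo[ (EFin \o (fun t : R => t `^ (z - 1) * expR (- t))).
Proof.
move=> z0.
pose K := (2 + 2 * (2 * z) `^ (2 * z)) / z.
pose h (t : R) := z * t `^ (z - 1) / (1 + t `^ z) ^+ 2.
have p0 (t : R) : 0 < 1 + t `^ z by rewrite ltr_pwDl// powR_ge0.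
have h0 t : 0 <= h t.
  by rewrite /h !mulr_ge0 ?powR_ge0 ?(ltW z0)// invr_ge0 exprn_ge0// ltW.
have mh : measurable_fun (`]0%R, +oo[%classic : set R) h.
  apply: measurable_funTS; apply: measurable_funM.
    by apply: measurable_funM => //; exact: measurable_powR.
  (* Real powers are measurable on the whole line, so the inverse square is
     read as the power of exponent -2. *)
  rewrite (_ : (fun t => _) = (fun t => (1 + t `^ z) `^ (- 2%:R))).
    apply: (@measurable_fun_powR _ _ _ (fun t : R => 1 + t `^ z)).
    by apply: measurable_funD => //; exact: measurable_powR.
  by apply/funext => t; rewrite powR_invn ?(ltW (p0 t)).
have ih : mu.-integrable `]0%R, +oo[ (EFin \o h).
  apply/integrableP; split; first exact/measurable_EFinP.
  under eq_integral => t _ do rewrite gee0_abs ?lee_fin ?h0//.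
  by rewrite ge0_integral_logistic// ltry.
apply: (le_integrable _ _ _ (integrableZl _ K ih)) => //.
  by apply/measurable_EFinP; exact: measurable_gamma_integrand.
move=> t /=; rewrite in_itv/= andbT => t0.
rewrite lee_fin ger0_norm ?gamma_integrand_ge0//.
by apply: le_trans (ler_norm _); exact: gamma_integrand_le.
Qed.

(** [Gamma z] is the finite part of an extended-real integral, hence equals that
    integral once it is known to converge. *)
Lemma EFin_Gamma (z : R) : 0 < z ->
  (Gamma z)%:E =
  (\int[mu]_(t in `]0%R, +oo[) (t `^ (z - 1) * expR (- t))%:E)%E.
Proof.
move=> z0; rewrite fineK//.
exact: (integrable_fin_num _ (integrable_gamma_integrand z z0)).
Qed.

(** If the integral of the nonnegative integrand vanished, the integrand would
    vanish almost everywhere, whereas it is positive on the unit interval. *)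
Lemma Gamma_gt0 (z : R) : 0 < z -> 0 < Gamma z.
Proof.
move=> z0; rewrite lt_neqAle; apply/andP; split; last first.
  by apply: Rintegral_ge0 => t _; exact: gamma_integrand_ge0.
apply/negP => /eqP G0.
have mf := measurable_int _ (integrable_gamma_integrand z z0).
have int0 : (\int[mu]_(t in `]0%R, +oo[)
    `|(EFin \o (fun t : R => t `^ (z - 1) * expR (- t))%R) t| = 0)%E.
  under eq_integral => t _ do
    rewrite gee0_abs ?lee_fin ?gamma_integrand_ge0//.
  by rewrite -EFin_Gamma// -G0.
have /negligibleS : ae_eq mu (`]0%R, +oo[%classic : set R)
    (EFin \o (fun t : R => t `^ (z - 1) * expR (- t))) (cst 0%E).
  exact: (ae_eq_integral_abs _ _ mf).1.
move=> /(_ `]0%R, 1%R[%classic) null.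
have : mu (`]0%R, 1%R[%classic : set R) = 0%E.
  apply: measure_negligible => //; apply: null => t.
  rewrite /= in_itv/= => /andP[t0 t1] /(_ _)/eqP.
  rewrite in_itv/= t0 => /(_ isT); rewrite eqe mulf_eq0.
  by rewrite !gt_eqF ?powR_gt0// expR_gt0.
rewrite lebesgue_measure_itv/= lte01 oppr0 adde0 => /eqP.
by rewrite eqe oner_eq0.
Qed.

End GammaFinite.

(** * Differentiation of Mellin transforms *)

Section Mellin.
Context {R : realType}.
Notation mu := lebesgue_measure.

Lemma is_derive1_powRr (t p : R) : 0 < t ->
  is_derive p 1 (fun q => t `^ (q - 1)) (t `^ (p - 1) * ln t).
Proof.
move=> t0; have tN0 : t != 0 by rewrite gt_eqF.
have E : (fun q => t `^ (q - 1)) = expR \o (fun q => (q - 1) * ln t).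
  by apply/funext => q; rewrite /powR (negbTE tN0).
have -> : t `^ (p - 1) = expR ((p - 1) * ln t) by rewrite /powR (negbTE tN0).
rewrite E; apply: is_derive1_comp.
have := is_deriveM (is_deriveB (is_derive_id p 1) (is_derive_cst (1 : R) p 1))
  (is_derive_cst (ln t) p 1).
by rewrite scaler0 add0r subr0 [_ *: 1]mulr1.
Qed.

(** Apply [e * ln t <= expR (e * ln t) = t `^ e] with [e = d] and [e = - d]: a
    logarithm costs an arbitrarily small change of exponent. *)
Lemma norm_ln_le (t d : R) : 0 < t -> 0 < d ->
  `|ln t| <= (t `^ d + t `^ (- d)) / d.
Proof.
move=> t0 d0; have tN0 : t != 0 by rewrite gt_eqF.
have E (e : R) : e * ln t <= t `^ e.
  rewrite /powR (negbTE tN0) (le_trans _ (expR_ge1Dx _))// lerDr.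
  exact: ler01.
rewrite ler_pdivlMr//.
have := E d; have := E (- d); have := powR_ge0 t d; have := powR_ge0 t (- d).
by have [l0|l0] := ler0P (ln t); lra.
Qed.

(** One of the two outer powers dominates according to whether [t <= 1]; the sum
    is a bound that is uniform in [t]. *)
Lemma powR_le_addr (t p q r : R) : 0 < t -> p <= q <= r ->
  t `^ q <= t `^ p + t `^ r.
Proof.
move=> t0 /andP[pq qr]; have [t1|t1] := leP t 1.
  by rewrite (le_trans (ger_powR _ pq)) ?t0// lerDl powR_ge0.
by rewrite (le_trans (ler_powR (ltW t1) qr))// lerDr powR_ge0.
Qed.

Context (D : set R) (w : R -> R) (mD : measurable D)
  (D_gt0 : forall t, D t -> 0 < t)
  (intw : forall z, 0 < z ->
    mu.-integrable D (EFin \o (fun t => t `^ (z - 1) * w t))).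

(** Bound on [t `^ (y - 1) * w t * ln t] uniform for [y] in the interval
    [(z / 2, 3 / 2 * z)].  The logarithm is absorbed by shifting the exponent by
    [z / 4] either way; the shifted exponents stay between [z / 4 - 1] and
    [2 * z - 1], which both give integrable functions. *)
Let dominating (z : R) : R -> R := fun t =>
  2 / (z / 4) * (`|t `^ (z / 4 - 1) * w t| + `|t `^ (2 * z - 1) * w t|).

Let integrable_dominating z : 0 < z ->
  mu.-integrable D (EFin \o dominating z).
Proof.
move=> z0; have z40 : 0 < z / 4 by rewrite divr_gt0.
have z20 : 0 < 2 * z by rewrite mulr_gt0.
apply: (integrableZl _ (2 / (z / 4)) (integrableD _
  (integrable_abse (intw _ z40)) (integrable_abse (intw _ z20)))) => //.
Qed.

Let dominatingP z y t : 0 < z -> z / 2 < y < 3 / 2 * z -> D t ->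
  `|t `^ (y - 1) * w t * ln t| <= dominating z t.
Proof.
move=> z0 /andP[zy yz] /D_gt0 t0; have z40 : 0 < z / 4 by rewrite divr_gt0.
rewrite /dominating !normrM !(ger0_norm (powR_ge0 _ _)) -mulrDl.
rewrite mulrAC mulrA ler_wpM2r//.
apply: (le_trans (ler_wpM2l (powR_ge0 _ _) (norm_ln_le _ _ t0 z40))).
rewrite mulrA ler_pdivrMr// mulrAC divfK ?gt_eqF// mulrDr.
have tN0 e : (e == 0) ==> (t != 0) by rewrite (gt_eqF t0) implybT.
rewrite -!powRD ?tN0// [leRHS]mulr_natl [leRHS]mulr2n.
by apply: lerD; apply: powR_le_addr => //; apply/andP; split; lra.
Qed.

Lemma integrable_mellin_ln (z : R) : 0 < z ->
  mu.-integrable D (EFin \o (fun t => t `^ (z - 1) * w t * ln t)).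
Proof.
move=> z0; apply: (le_integrable _ _ _ (integrable_dominating z z0)) => //.
  apply/measurable_EFinP; apply: measurable_funM.
    by have /measurable_int/measurable_EFinP := intw z z0.
  by apply: measurable_funTS; exact: measurable_ln.
move=> t Dt; rewrite lee_fin; apply: le_trans (ler_norm _).
apply: dominatingP => //; apply/andP; split; lra.
Qed.

(** Differentiation of a Mellin transform under the integral sign: the
    [y]-derivative of [t `^ (y - 1)] is [t `^ (y - 1) * ln t], and it is
    dominated by an integrable function locally uniformly in [y]. *)
Lemma is_derive1_mellin (z : R) : 0 < z ->
  is_derive z 1 (fun y => \int[mu]_(t in D) (t `^ (y - 1) * w t))
    (\int[mu]_(t in D) (t `^ (z - 1) * w t * ln t)).
Proof.
move=> z0.
have df (y t : R) : D t ->
    is_derive y 1 (fun y => t `^ (y - 1) * w t) (t `^ (y - 1) * w t * ln t).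
  move=> /D_gt0 t0.
  have := is_deriveM (is_derive1_powRr t y t0) (is_derive_cst (w t) y 1).
  by rewrite scaler0 add0r [w t *: _]mulrC mulrAC.
have Iz : (`](z / 2), (3 / 2 * z)[%classic : set R) z.
  by rewrite /= in_itv/=; apply/andP; split; lra.
have Igt0 y : (`](z / 2), (3 / 2 * z)[%classic : set R) y -> 0 < y.
  by rewrite /= in_itv/= => /andP[zy _]; lra.
have G0 t : 0 <= dominating z t.
  by rewrite /dominating mulr_ge0 ?addr_ge0// divr_ge0// ltW// divr_gt0.
pose f := fun y t => t `^ (y - 1) * w t.
have d1E y t : D t -> partial1of2 f y t = t `^ (y - 1) * w t * ln t.
  by move=> Dt; rewrite partial1of2E; have [_ <-] := df y t Dt.
have intf y : (`](z / 2), (3 / 2 * z)[%classic : set R) y ->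
  mu.-integrable D (EFin \o f y) by move=> /Igt0; exact: intw.
have derf y t : (`](z / 2), (3 / 2 * z)[%classic : set R) y -> D t ->
  derivable (f ^~ t) y 1 by move=> _ /(df y)[].
have Gub y t : (`](z / 2), (3 / 2 * z)[%classic : set R) y -> D t ->
    `|partial1of2 f y t| <= dominating z t.
  by move=> yI Dt; rewrite d1E//; apply: dominatingP.
apply: DeriveDef.
  have dM := @derivable_under_integral R _ (measurableTypeR R) mu f D mD z _ _
    Iz intf derf _ G0 (integrable_dominating z z0) Gub.
  exact: dM.
rewrite -derive1E.
rewrite (@differentiation_under_integral R _ (measurableTypeR R) mu f D mD z _ _
  Iz intf derf _ G0 (integrable_dominating z z0) Gub).
by apply: eq_Rintegral => t; rewrite inE => /d1E ->.
Qed.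

End Mellin.

(** * Exchange of integrations and scaling of the Gamma integral *)

Section Beta.
Context {R : realType}.
Notation mu := lebesgue_measure.

(** Tonelli's theorem on a rectangle, by extending the integrand by 0. *)
Lemma ge0_fubini_tonelli_rect (A B : set R) (f : R -> R -> R) :
  measurable A -> measurable B ->
  measurable_fun [set: R * R] (fun z => f z.1 z.2) ->
  (forall x y, 0 <= f x y) ->
  (\int[mu]_(x in A) \int[mu]_(y in B) (f x y)%:E =
   \int[mu]_(y in B) \int[mu]_(x in A) (f x y)%:E)%E.
Proof.
move=> mA mB mf f0.
pose g : R * R -> \bar R := (fun z => (f z.1 z.2)%:E) \_ (A `*` B).
have g0 z : (0 <= g z)%E.
  by rewrite /g patchE; case: ifPn => // _; rewrite lee_fin.
have mg : measurable_fun [set: R * R] g.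
  apply/(measurable_restrictT _ _).1; first exact: measurableX.
  by apply/measurable_EFinP; exact: measurable_funTS.
have gE x y : g (x, y) = if (x \in A) && (y \in B) then (f x y)%:E else 0%E.
  by rewrite /g patchE in_setX.
have E := fubini_tonelli (m1 := mu) (m2 := mu) g mg g0.
transitivity (\int[mu]_x \int[mu]_y g (x, y))%E.
  rewrite integral_mkcond; apply: eq_integral => x _; rewrite patchE.
  case: ifPn => xA; last first.
    by rewrite integral0_eq// => y _; rewrite gE (negbTE xA).
  rewrite integral_mkcond; apply: eq_integral => y _.
  by rewrite patchE gE xA.
rewrite E [RHS]integral_mkcond; apply: eq_integral => y _; rewrite patchE.
case: ifPn => yB; last first.
  by rewrite integral0_eq// => x _; rewrite gE (negbTE yB) andbF.
rewrite [RHS]integral_mkcond; apply: eq_integral => x _.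
by rewrite patchE gE yB andbT.
Qed.

Lemma continuous_gamma_integrand (z x : R) : 0 < x ->
  {for x, continuous (fun t => t `^ (z - 1) * expR (- t))}.
Proof.
move=> x0; apply: (@continuousM R R (fun t => t `^ (z - 1))).
  exact: continuous_powR_gt0.
apply: (@continuous_comp _ _ _ (fun t => - t) expR).
  exact: oppr_continuous.
exact: continuous_expR.
Qed.

Lemma gt0_powRD (x r s : R) : 0 < x -> x `^ (r + s) = x `^ r * x `^ s.
Proof. by move=> x0; rewrite powRD// (gt_eqF x0) implybT. Qed.

Lemma integral_gamma_scaled (z k : R) : 0 < z -> 0 < k ->
  (\int[mu]_(s in `]0%R, +oo[) (s `^ (z - 1) * expR (- (k * s)))%:E =
   (k `^ (- z) * Gamma z)%:E)%E.
Proof.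
move=> z0 k0.
rewrite EFinM EFin_Gamma// (ge0_integral_scaling k _ k0
  (continuous_gamma_integrand z) (fun x _ => gamma_integrand_ge0 z x)).
rewrite -ge0_integralZl//; last 3 first.
- apply/measurable_EFinP; apply: measurable_funM => //; apply: measurable_funTS.
  apply: measurable_funM.
    by apply: measurable_fun_powR; exact: measurable_funM.
  by apply: measurableT_comp => //; apply: measurableT_comp.
- move=> x; rewrite /= in_itv/= andbT => x0.
  by rewrite lee_fin mulr_ge0 ?gamma_integrand_ge0// ltW.
- by rewrite lee_fin powR_ge0.
apply: eq_integral => s; rewrite inE/= in_itv/= andbT => s0.
rewrite -EFinM; congr EFin.
have kz : k `^ z = k * k `^ (z - 1) by rewrite mulr_powRB1// ltW.
rewrite powRM ?(ltW k0) ?(ltW s0)// powRN kz.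
have := powR_gt0 (z - 1) k0; move: (k `^ (z - 1)) => u u0.
by field; rewrite !gt_eqF.
Qed.

End Beta.

(** * A Beta-type integral *)

Section BetaIntegral.
Context {R : realType}.
Notation mu := lebesgue_measure.
Context (c : R) (c0 : 0 < c).

Lemma powRN_gt1 (x : R) : 0 < x < 1 -> 1 < x `^ (- c).
Proof.
move=> /andP[x0 x1]; rewrite powRN invf_gt1 ?powR_gt0//.
have := gt0_ltr_powR c0; move=> /(_ x 1); rewrite !nnegrE powR1.
by apply => //; exact: ltW.
Qed.

Lemma is_derive1_powRN_sub1 (s x : R) : 0 < x ->
  is_derive x 1 (fun x => s * (x `^ (- c) - 1)) (s * (- c * x `^ (- c - 1))).
Proof.
move=> x0.
have := is_deriveZ s (is_deriveB (is_derive1_powR (- c) x0)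
  (is_derive_cst (1 : R) x 1)).
by rewrite subr0.
Qed.

Lemma image_powRN_sub1 (s : R) : 0 < s ->
  [set s * (x `^ (- c) - 1) | x in `]0%R, 1%R[%classic] = `]0, +oo[%classic.
Proof.
move=> s0; apply/seteqP; split => [_ [x + <-]|t]; rewrite /= !in_itv/= !andbT.
  by move=> /powRN_gt1 x1; rewrite mulr_gt0// subr_gt0.
move=> t0; have ts1 : 1 < 1 + t / s by rewrite ltrDl divr_gt0.
have ts0 : 0 < 1 + t / s by rewrite (lt_trans _ ts1).
exists ((1 + t / s) `^ (- c^-1)).
  rewrite /= in_itv/= powR_gt0//= powRN invf_lt1 ?powR_gt0//.
  have := @gt0_ltr_powR _ c^-1; rewrite invr_gt0 => /(_ c0 1 (1 + t / s)).
  by rewrite !nnegrE powR1; apply => //; exact: ltW.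
rewrite -powRrM mulrNN mulVf ?gt_eqF// powRr1 ?(ltW ts0)//.
by rewrite addrC addKr mulrCA divff ?mulr1// gt_eqF.
Qed.

(** The variable [t = s * (x `^ (- c) - 1)] maps the unit interval onto the
    half-line.  The scale [s] is the variable of the other Gamma integral; this
    choice turns the exponential factors of the product of the two integrals
    into [expR (- (s * x `^ (- c)))]. *)
Lemma Gamma_substituted (q s : R) : 0 < q -> 0 < s ->
  (Gamma q)%:E = (\int[mu]_(x in `]0%R, 1%R[)
    ((s * (x `^ (- c) - 1)) `^ (q - 1) * expR (- (s * (x `^ (- c) - 1))) *
     (s * (c * x `^ (- c - 1))))%:E)%E.
Proof.
move=> q0 s0; rewrite EFin_Gamma// -{1}(image_powRN_sub1 s s0).
have lt0 (x : R) : 0 < x < 1 -> 0 < x by move=> /andP[].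
rewrite (ge0_integration_by_substitution_decreasing_01 _ _ _
  (fun x x01 => is_derive1_powRN_sub1 s x (lt0 x x01))).
- apply: eq_integral => x _; congr EFin; congr (_ * _).
  by rewrite -mulrN mulNr opprK.
- move=> x /lt0 x0.
  apply: (@continuousM R R (fun=> s)); first exact: cst_continuous.
  apply: (@continuousM R R (fun=> - c)); first exact: cst_continuous.
  exact: continuous_powR_gt0.
- move=> x /lt0 x0; rewrite mulNr mulrN oppr_lt0 !mulr_gt0// powR_gt0//.
- move=> x /powRN_gt1 x1; apply: continuous_gamma_integrand.
  by rewrite mulr_gt0// subr_gt0.
- by move=> x _; exact: gamma_integrand_ge0.
Qed.

(** Joint integrand of [Gamma p * Gamma q] in the variables [s] and [x]. *)
Let K (p q s x : R) := (s `^ (p + q - 1) * expR (- (x `^ (- c) * s))) *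
  (c * x `^ (- c - 1) * (x `^ (- c) - 1) `^ (q - 1)).

Let measurable_K p q : measurable_fun [set: R * R] (fun z => K p q z.1 z.2).
Proof.
apply: measurable_funM.
  apply: measurable_funM; first exact: measurable_fun_powR.
  apply: measurableT_comp => //; apply: measurableT_comp => //.
  by apply: measurable_funM => //; exact: measurable_fun_powR.
apply: measurable_funM.
  by apply: measurable_funM => //; exact: measurable_fun_powR.
apply: measurable_fun_powR; apply: measurable_funB => //.
exact: measurable_fun_powR.
Qed.

Let K_ge0 p q s x : 0 <= K p q s x.
Proof. by rewrite /K !mulr_ge0 ?powR_ge0 ?expR_ge0 ?(ltW c0). Qed.

Let integral_K_x p q s : 0 < q -> 0 < s ->
  (\int[mu]_(x in `]0%R, 1%R[) (K p q s x)%:E =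
   (s `^ (p - 1) * expR (- s))%:E * (Gamma q)%:E)%E.
Proof.
move=> q0 s0; rewrite (Gamma_substituted q s q0 s0) -ge0_integralZl//.
- apply: eq_integral => x; rewrite inE/= in_itv/= => x01.
  have x1 := powRN_gt1 _ x01.
  rewrite -EFinM; congr EFin; rewrite /K.
  rewrite powRM ?(ltW s0) ?subr_ge0 ?(ltW x1)//.
  have -> : s `^ (p + q - 1) = s `^ (p - 1) * s `^ (q - 1) * s.
    rewrite -{4}(powRr1 (ltW s0)) -!gt0_powRD//; congr (_ `^ _); ring.
  have -> : expR (- (x `^ (- c) * s)) =
      expR (- s) * expR (- (s * (x `^ (- c) - 1))).
    by rewrite -expRD; congr expR; ring.
  ring.
- apply/measurable_EFinP; apply: measurable_funTS; apply: measurable_funM.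
    apply: measurable_funM.
      apply: measurable_fun_powR; apply: measurable_funM => //.
      by apply: measurable_funB => //; exact: measurable_fun_powR.
    apply: measurableT_comp => //; apply: measurableT_comp => //.
    apply: measurable_funM => //.
    by apply: measurable_funB => //; exact: measurable_fun_powR.
  apply: measurable_funM => //; apply: measurable_funM => //.
- move=> x _; rewrite lee_fin.
  by rewrite !mulr_ge0 ?powR_ge0 ?expR_ge0 ?(ltW c0) ?(ltW s0).
- by rewrite lee_fin gamma_integrand_ge0.
Qed.

Let integral_K_s p q x : 0 < p + q -> 0 < x < 1 ->
  (\int[mu]_(s in `]0%R, +oo[) (K p q s x)%:E =
   (c * Gamma (p + q) * (x `^ (c * p - 1) * (1 - x `^ c) `^ (q - 1)))%:E)%E.
Proof.
move=> pq0 x01; have x1 := powRN_gt1 _ x01.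
have x0 : 0 < x by case/andP: x01.
under eq_integral => s _ do rewrite /K EFinM.
rewrite ge0_integralZr//; last 3 first.
- apply/measurable_EFinP; apply: measurable_funTS.
  apply: measurable_funM; first exact: measurable_fun_powR.
  by apply: measurableT_comp => //; apply: measurableT_comp.
- by move=> s _; rewrite lee_fin mulr_ge0 ?powR_ge0 ?expR_ge0.
- by rewrite lee_fin !mulr_ge0 ?powR_ge0 ?(ltW c0).
rewrite integral_gamma_scaled ?powR_gt0// -EFinM; congr EFin.
have -> : x `^ (- c) - 1 = x `^ (- c) * (1 - x `^ c).
  by rewrite mulrBr mulr1 -gt0_powRD// addNr powRr0.
have xc1 : x `^ c <= 1.
  by move: (ltW x1); rewrite powRN invf_ge1 ?powR_gt0.
rewrite powRM ?powR_ge0 ?subr_ge0// -!powRrM.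
have -> : x `^ (c * p - 1) =
    x `^ (- c * - (p + q)) * x `^ (- c - 1) * x `^ (- c * (q - 1)).
  by rewrite -!gt0_powRD//; congr (_ `^ _); ring.
ring.
Qed.

(** The double integral of [K] is computed in both orders: integrating first in
    [x] gives [Gamma p * Gamma b], integrating first in [s] leaves
    [c * Gamma (p + b)] times the integral sought, where [p = a / c]. *)
Lemma integral_beta_type (a b : R) : 0 < a -> 0 < b ->
  (\int[mu]_(x in `]0%R, 1%R[) (x `^ (a - 1) * (1 - x `^ c) `^ (b - 1))%:E =
   (Gamma (a / c) * Gamma b / (c * Gamma (a / c + b)))%:E)%E.
Proof.
move=> a0 b0; set p := a / c.
have p0 : 0 < p by rewrite divr_gt0.
have pb0 : 0 < p + b by rewrite addr_gt0.
have gpb := Gamma_gt0 _ pb0.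
have mw (D : set R) : measurable_fun D
    (fun x : R => x `^ (a - 1) * (1 - x `^ c) `^ (b - 1)).
  apply: measurable_funTS; apply: measurable_funM => //.
  by apply: measurable_fun_powR; apply: measurable_funB.
have : ((Gamma p * Gamma b)%:E = (c * Gamma (p + b))%:E *
    \int[mu]_(x in `]0%R, 1%R[) (x `^ (a - 1) * (1 - x `^ c) `^ (b - 1))%:E)%E.
  transitivity (\int[mu]_(s in `]0%R, +oo[)
      \int[mu]_(x in `]0%R, 1%R[) (K p b s x)%:E)%E.
    transitivity (\int[mu]_(s in `]0%R, +oo[)
        ((s `^ (p - 1) * expR (- s))%:E * (Gamma b)%:E))%E.
      rewrite ge0_integralZr//; last 3 first.
      - by apply/measurable_EFinP; exact: (measurable_gamma_integrand p).
      - by move=> x _; rewrite lee_fin gamma_integrand_ge0.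
      - by rewrite lee_fin; exact/ltW/Gamma_gt0.
      by rewrite -EFin_Gamma// EFinM.
    apply: eq_integral => s; rewrite inE/= in_itv/= andbT => s0.
    by rewrite integral_K_x.
  rewrite (ge0_fubini_tonelli_rect _ _ (K p b) (measurable_itv _)
    (measurable_itv _) (measurable_K p b) (K_ge0 p b)).
  rewrite -ge0_integralZl//; last 3 first.
  - by apply/measurable_EFinP; exact: (mw _).
  - by move=> x _; rewrite lee_fin mulr_ge0 ?powR_ge0.
  - by rewrite lee_fin ltW// mulr_gt0.
  apply: eq_integral => x; rewrite inE/= in_itv/= => x01.
  rewrite integral_K_s// -EFinM.
  by rewrite /p [c * (a / c)]mulrCA divff ?mulr1// gt_eqF.
move=> E; rewrite EFinM E muleC.
have cg : c * Gamma (p + b) != 0 by rewrite gt_eqF// mulr_gt0.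
by rewrite muleA -EFinM mulVf// mul1e.
Qed.

End BetaIntegral.

(** * The logarithmic integral *)

Section Digamma.
Context {R : realType}.
Notation mu := lebesgue_measure.

(** The derivative of [Gamma], taken under the integral sign. *)
Definition dGamma (z : R) : R :=
  \int[mu]_(t in `]0%R, +oo[) (t `^ (z - 1) * expR (- t) * ln t).

(** [Gamma] is the Mellin transform of [expR (- t)] on the half-line. *)
Lemma is_derive1_Gamma (z : R) : 0 < z -> is_derive z 1 (@Gamma R) (dGamma z).
Proof.
apply: is_derive1_mellin => //.
- by move=> t; rewrite /= in_itv/= andbT.
- exact: integrable_gamma_integrand.
Qed.

Lemma digammaE (z : R) : 0 < z -> digamma z = dGamma z / Gamma z.
Proof.
move=> z0; rewrite /digamma derive1E.
have [_ ->] := is_derive1_comp (is_derive1_ln (Gamma_gt0 z z0))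
  (is_derive1_Gamma z z0).
by rewrite mulrC.
Qed.

Lemma integrable_beta_integrand (b c z : R) : 0 < b -> 0 < c -> 0 < z ->
  mu.-integrable `]0%R, 1%R[
    (EFin \o (fun x : R => x `^ (z - 1) * (1 - x `^ c) `^ (b - 1))).
Proof.
move=> b0 c0 z0; apply/integrableP; split.
  apply/measurable_EFinP; apply: measurable_funTS; apply: measurable_funM => //.
  by apply: measurable_fun_powR; apply: measurable_funB.
under eq_integral => x _ do
  rewrite gee0_abs ?lee_fin ?mulr_ge0 ?powR_ge0//.
by rewrite integral_beta_type// ltry.
Qed.

(** Quotient rule: [digammaE] writes each derivative of a Gamma value as that
    value times digamma, and the inner [y / c] contributes the second factor
    [c^-1]. *)
Lemma is_derive1_beta (a b c : R) : 0 < a -> 0 < b -> 0 < c ->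
  is_derive a 1 (fun y => Gamma (y / c) * Gamma b / (c * Gamma (y / c + b)))
    (Gamma (a / c) * Gamma b / (c ^+ 2 * Gamma (a / c + b)) *
      (digamma (a / c) - digamma (a / c + b))).
Proof.
move=> a0 b0 c0.
have p0 : 0 < a / c by rewrite divr_gt0.
have pb0 : 0 < a / c + b by rewrite addr_gt0.
have gp := Gamma_gt0 _ p0; have gpb := Gamma_gt0 _ pb0.
have dlin : is_derive a 1 (fun y => y / c) c^-1.
  have := is_deriveM (is_derive_id a 1) (is_derive_cst (c^-1 : R) a 1).
  by rewrite scaler0 add0r [_ *: 1]mulr1.
have daff : is_derive a 1 (fun y => y / c + b) c^-1.
  by have := is_deriveD dlin (is_derive_cst (b : R) a 1); rewrite addr0.
have dN := @is_derive1_comp R (@Gamma R) (fun y => y / c) a _ _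
  (is_derive1_Gamma _ p0) dlin.
have dD := @is_derive1_comp R (@Gamma R) (fun y => y / c + b) a _ _
  (is_derive1_Gamma _ pb0) daff.
have cD0 : c * Gamma (a / c + b) != 0 by rewrite gt_eqF// mulr_gt0.
have dcD := is_deriveZ c dD.
have dV := @is_deriveV R (fun y => c * Gamma (y / c + b)) a _ 1 cD0 dcD.
have dNb := is_deriveM dN (is_derive_cst (Gamma b : R) a 1).
have dB : is_derive a 1
    (fun y => Gamma (y / c) * Gamma b / (c * Gamma (y / c + b))) _ :=
  is_deriveM dNb dV.
apply: (is_derive_eq dB).
rewrite !digammaE// /GRing.scale/=.
rewrite -[(_ * cst _) a]/(Gamma (a / c) * Gamma b).
move: (Gamma (a / c)) (Gamma (a / c + b)) (dGamma (a / c)) (dGamma (a / c + b))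
  (Gamma b) gp gpb => u v du dv k u0 v0.
by field; rewrite !gt_eqF.
Qed.

End Digamma.

Theorem corollary9p2 (R : realType) (a b c : R)
    (a_gt0 : 0 < a) (b_gt0 : 0 < b) (c_gt0 : 0 < c) :
  (\int[lebesgue_measure]_(x in `]0%R, 1%R[)
     (x `^ (a - 1) * (1 - x `^ c) `^ (b - 1) * ln x)%:E)%E =
  (Gamma (a / c) * Gamma b / (c ^+ 2 * Gamma (a / c + b)) *
     (digamma (a / c) - digamma (a / c + b)))%:E.
Proof.
pose w (x : R) := (1 - x `^ c) `^ (b - 1).
have mD : measurable (`]0%R, 1%R[%classic : set R) by [].
have D_gt0 (t : R) : `]0%R, 1%R[%classic t -> 0 < t.
  by rewrite /= in_itv/= => /andP[].
have intw (z : R) := integrable_beta_integrand b c z b_gt0 c_gt0.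
have [_ dM] := is_derive1_mellin _ w mD D_gt0 intw a a_gt0.
have ilog := integrable_mellin_ln _ w mD D_gt0 intw a a_gt0.
(* Integrability allows passing from the extended-real to the real integral,
   which is the derivative at [a] of a Mellin transform. *)
rewrite -[LHS]fineK; last exact: (integrable_fin_num _ ilog).
congr EFin; rewrite [LHS](esym dM).
have [_ <-] := is_derive1_beta a b c a_gt0 b_gt0 c_gt0.
apply: near_eq_derive; near=> y.
rewrite [LHS]/Rintegral integral_beta_type//.
by near: y; exact: lt_nbhsr.
Unshelve. all: end_near. Qed.
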